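(* Let $n\ge1$, let $\mathbf{Q}=(Q_1,\dots,Q_k)$ be a fermionic multiline queue on $n$ sites (of type $(\alpha,n)$ for an arbitrary weak composition $\alpha$), and let $\mathbf{b}=Q_1\otimes\cdots\otimes Q_k\in\mathcal{B}^{\alpha_1}\otimes\cdots\otimes\mathcal{B}^{\alpha_k}$ be the corresponding element. Then $$\Phi(\mathbf{Q})=\pi(\mathbf{b}).$$
   Context: Fix $n\ge1$, $[n]=\{1,\dots,n\}$; sites are considered cyclically (in $\mathbb{Z}/n\mathbb{Z}$). A weak composition is a finite sequence of nonnegative integers. A fermionic multiline queue of type $(\alpha,n)$, $\alpha=(\alpha_1,\dots,\alpha_k)$, is a tuple $\mathbf{Q}=(Q_1,\dots,Q_k)$ with $Q_j\subseteq[n]$, $|Q_j|=\alpha_j$ (row 1 is the bottom row). Let $\mathcal{W}$ be the set of words $(a_1,\dots,a_n)$ of nonnegative integers; for $u\in\mathcal{W}$, $u_+$ is the multiset of nonzero entries. For $Q\subseteq[n]$, $\iota(Q)\in\{0,1\}^n$ is its indicator vector. Pairing. For $A,B\subseteq[n]$ ($A$ the lower row, $B$ the upper row), $\mathrm{cpair_f}(A,B)$ is: for $j=1,\dots,n$ in order, write an open bracket ''('' if $j\in B$ and then a closed bracket '')'' if $j\in A$; view the bracket word on a circle and recursively match each ''('' with a '')'' following it cyclically when there are no unmatched brackets between them. An element of $A$ or $B$ is paired (unpaired) if its bracket is matched (unmatched). Crystals and R matrix. $\mathcal{B}^r$ is the set of $r$-element subsets of $[n]$ (single-column Kirillov–Reshetikhin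 crystal of type $A^{(1)}_{n-1}$), and a tensor product is, as a set, a Cartesian product. The combinatorial R matrix $\mathcal{R}:\mathcal{B}^{r}\otimes\mathcal{B}^{r'}\to\mathcal{B}^{r'}\otimes\mathcal{B}^{r}$ is given by the Nakayashiki–Yamada rule: $\mathcal{R}(b\otimes c)$ is obtained from $b\otimes c$ by moving all elements unpaired in $\mathrm{cpair_f}(b,c)$ from the first factor to the second and from the second to the first. $\mathcal{R}_i$ applies $\mathcal{R}$ to the factors $i,i+1$. Projection $\pi$. Write $\mathcal{R}_{[a,b]}=\mathcal{R}_a\circ\mathcal{R}_{a+1}\circ\cdots\circ\mathcal{R}_b$ (applied right to left; identity if $b<a$) and $(X)_1$ for the first tensor factor of $X$, viewed as an indicator vector. Then $\pi(\mathbf{b})=\sum_{i=1}^k\bigl(\mathcal{R}_{[1,i-1]}(\mathbf{b})\bigr)_1\in\mathcal{W}$. Operators $Q^{(\ell)}$. For $Q\subseteq[n]$, $\ell\ge1$ and $\mathbf{u}=(u_1,\dots,u_n)\in\mathcal{W}$ with $\ell<\min(\mathbf{u}_+)$, define $Q^{(\ell)}(\mathbf{u})=(y_1,\dots,y_n)$ as follows. Initialize all $y_j=0$. Let $a=\min(\mathbf{u}_+)$, $K=\max(\mathbf{u}_+)$, $u^{(r)}=\{j:u_j\ge r\}$. Pairing phase: let $s$ be the maximal $r\in\{a,\dots,K\}$ with $|u^{(r)}|\ge|Q|$, if it exists, and $s=a$ otherwise. For $r=K,K-1,\dots,s$: for each $j\in Q$ which is paired in $\mathrm{cpair_f}(Q,u^{(r)})$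 for the first time at step $r$, set $y_j=r$. Then for each $j\in Q$ unpaired in $\mathrm{cpair_f}(Q,u^{(s)})$, set $y_j=\ell$. Collapsing phase: for $r=s,s-1,\dots,a$: for each $j\in u^{(r)}$ newly unpaired (unpaired in $\mathrm{cpair_f}(Q,u^{(r)})$ and not unpaired in $\mathrm{cpair_f}(Q,u^{(r+1)})$), set $y_j=r-1$. For the zero word $\mathbf{w}_0=(0,\dots,0)$, $Q^{(\ell)}(\mathbf{w}_0)=\ell\cdot\iota(Q)$. Projection $\Phi$: $\Phi(\mathbf{Q})=Q_1^{(1)}\bigl(Q_2^{(2)}(\cdots Q_k^{(k)}(\mathbf{w}_0)\cdots)\bigr)$. *)

(* Defs.v *)
From mathcomp Require Import all_boot.

Set Implicit Arguments.
Unset Strict Implicit.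
Unset Printing Implicit Defensive.

(* Conventions: the sites 1, ..., n are the elements 0, ..., n.-1 of 'I_n, in
   the same cyclic order.  Rows of multiline queues, tensor factors and labels
   are numbered from 1: row j of Q is the j-th entry of the sequence Q. *)

Definition word (n : nat) := {ffun 'I_n -> nat}.

Definition word0 (n : nat) : word n := [ffun=> 0].

Definition indicator (n : nat) (Q : {set 'I_n}) : word n :=
  [ffun j => nat_of_bool (j \in Q)].

(* the crystal B^r, as a set *)
Definition column (n r : nat) : {set {set 'I_n}} := [set b : {set 'I_n} | #|b| == r].

(* Q = (Q_1, ..., Q_k) is a fermionic multiline queue of type (alpha, n);
   equivalently Q, read as Q_1 (x) ... (x) Q_k, is an element of
   B^(alpha_1) (x) ... (x) B^(alpha_k). *)
Definition is_fmlq (n : nat) (alpha : seq nat) (Q : seq {set 'I_n}) : bool :=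
  all2 (fun r (b : {set 'I_n}) => b \in column n r) alpha Q.

(** ** Cyclic pairing *)

(* The bracket (j, false) is the "(" of site j and (j, true) its ")".  On the
   circle of length 2n they sit at positions 2j and 2j + 1, so that at each
   site the "(" comes first. *)
Notation bracket n := ('I_n * bool)%type.

Definition bracket_pos (n : nat) (x : bracket n) : nat := x.1.*2 + x.2.

(* the number of steps forward from x to y on the circle *)
Definition cdist (n : nat) (x y : bracket n) : nat :=
  (bracket_pos y + n.*2 - bracket_pos x) %% n.*2.

Definition cbetween (n : nat) (x y z : bracket n) : bool :=
  0 < cdist x z < cdist x y.

(* the bracket word of cpair_f(A, B), with A the lower and B the upper row *)
Definition brackets (n : nat) (A B : {set 'I_n}) : {set bracket n} :=
  [set x : bracket n | if x.2 then x.1 \in A else x.1 \in B].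

Definition is_matched (n : nat) (M : {set bracket n * bracket n})
    (x : bracket n) : bool :=
  [exists m in M, (m.1 == x) || (m.2 == x)].

(* One round of matching: each unmatched "(" is matched with the unmatched ")"
   following it cyclically with no unmatched bracket in between. *)
Definition match_round (n : nat) (A B : {set 'I_n})
    (M : {set bracket n * bracket n}) : {set bracket n * bracket n} :=
  M :|: [set m : bracket n * bracket n |
    [&& m.1 \in brackets A B, ~~ m.1.2, ~~ is_matched M m.1,
        m.2 \in brackets A B, m.2.2, ~~ is_matched M m.2
      & [forall z in brackets A B, cbetween m.1 m.2 z ==> is_matched M z]]].

(* A round that changes anything adds at least one of the at most n matched
   pairs, so n rounds reach the final matching. *)
Definition cpair (n : nat) (A B : {set 'I_n}) : {set bracket n * bracket n} :=
  iter n (match_round A B) set0.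

Definition paired_lower (n : nat) (A B : {set 'I_n}) : {set 'I_n} :=
  [set j in A | is_matched (cpair A B) (j, true)].

Definition unpaired_lower (n : nat) (A B : {set 'I_n}) : {set 'I_n} :=
  [set j in A | ~~ is_matched (cpair A B) (j, true)].

Definition unpaired_upper (n : nat) (A B : {set 'I_n}) : {set 'I_n} :=
  [set j in B | ~~ is_matched (cpair A B) (j, false)].

(** ** Combinatorial R matrix and the projection pi *)

Definition Rmx (n : nat) (b c : {set 'I_n}) : {set 'I_n} * {set 'I_n} :=
  let ub := unpaired_lower b c in
  let uc := unpaired_upper b c in
  ((b :\: ub) :|: uc, (c :\: uc) :|: ub).

(* R_i, acting on the factors i and i + 1, for 1 <= i < size X (for other i it
   is the identity) *)
Fixpoint Rmx_at (n i : nat) (X : seq {set 'I_n}) : seq {set 'I_n} :=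
  match i, X with
  | 1, b :: c :: X' => (Rmx b c).1 :: (Rmx b c).2 :: X'
  | i'.+1, b :: X' => b :: Rmx_at i' X'
  | _, _ => X
  end.

(* R_[a,b] = R_a o R_(a+1) o ... o R_b; the identity if b < a *)
Definition Rmx_range (n a b : nat) (X : seq {set 'I_n}) : seq {set 'I_n} :=
  foldr (@Rmx_at n) X (index_iota a b.+1).

Definition factor1 (n : nat) (X : seq {set 'I_n}) : {set 'I_n} := head set0 X.

Definition pi_word (n : nat) (b : seq {set 'I_n}) : word n :=
  [ffun j => \sum_(1 <= i < (size b).+1)
               indicator (factor1 (Rmx_range 1 i.-1 b)) j].

(** ** The operators Q^(l) and the projection Phi *)

Definition posvals (n : nat) (u : word n) : seq nat :=
  [seq x <- codom u | 0 < x].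

Definition word_max (n : nat) (u : word n) : nat :=
  \max_(x <- posvals u) x.

(* min (u_+), for u nonzero: the maximum is then a harmless initial value *)
Definition word_min (n : nat) (u : word n) : nat :=
  \big[minn/word_max u]_(x <- posvals u) x.

Definition level (n : nat) (u : word n) (r : nat) : {set 'I_n} :=
  [set j | r <= u j].

(* the index s: the last, hence largest, r in {a, ..., K} with
   #|u^(r)| >= #|Q|, and a if there is none *)
Definition split_level (n : nat) (Q : {set 'I_n}) (u : word n) : nat :=
  last (word_min u)
    [seq r <- index_iota (word_min u) (word_max u).+1 | #|Q| <= #|level u r|].

Definition pairing_step (n : nat) (Q : {set 'I_n}) (u y : word n) (r : nat) :
    word n :=
  [ffun j => if (j \in paired_lower Q (level u r))
               && all (fun r' => j \notin paired_lower Q (level u r'))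
                    (index_iota r.+1 (word_max u).+1)
             then r else y j].

Definition unpaired_step (n : nat) (Q : {set 'I_n}) (l : nat) (u y : word n) :
    word n :=
  [ffun j => if j \in unpaired_lower Q (level u (split_level Q u))
             then l else y j].

Definition collapsing_step (n : nat) (Q : {set 'I_n}) (u y : word n) (r : nat) :
    word n :=
  [ffun j => if (j \in unpaired_upper Q (level u r))
               && (j \notin unpaired_upper Q (level u r.+1))
             then r.-1 else y j].

(* Q^(l)(u), meaningful for u = 0 and for 1 <= l < min (u_+); y0, y1, y2 and
   the result are the successive states of (y_1, ..., y_n). *)
Definition mlq_op (n : nat) (Q : {set 'I_n}) (l : nat) (u : word n) : word n :=
  if u == word0 n then [ffun j => l * indicator Q j]
  else
    let s := split_level Q u in
    let y0 := word0 n in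
    let y1 := foldl (pairing_step Q u) y0
                (rev (index_iota s (word_max u).+1)) in
    let y2 := unpaired_step Q l u y1 in
    foldl (collapsing_step Q u) y2 (rev (index_iota (word_min u) s.+1)).

(* Q_1^(l) (Q_2^(l+1) ( ... )) for the sequence Q_1, Q_2, ... *)
Fixpoint Phi_from (n l : nat) (Q : seq {set 'I_n}) : word n :=
  match Q with
  | [::] => word0 n
  | Q1 :: Q' => mlq_op Q1 l (Phi_from l.+1 Q')
  end.

Definition Phi (n : nat) (Q : seq {set 'I_n}) : word n := Phi_from 1 Q.

(* Main.v *)
Require Import Defs.
From mathcomp Require Import all_boot zify.

Set Implicit Arguments.
Unset Strict Implicit.
Unset Printing Implicit Defensive.

(** For rows [A] (lower) and [B] (upper), let [front A B] be the first factor of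
    the R matrix applied to [A (x) B].  Moving row [i] to the front of
    [A :: Q] first moves it to the front of [Q] and then past [A], so the sets
    whose indicators [pi_word] adds up are [A] itself together with all
    [front A C], where [C] runs through the sets obtained from [Q]
    ([fronts_Rmx_range]).  The proof rests on two facts.

    - [front] is monotone in its second argument ([front_mono]), and [front A B] is
      always comparable with [A] ([front_comparable]).  By induction on the
      queue, the sets contributing to [pi_word Q] therefore form a chain
      ([fronts_comparable]).
    - For a chain, the family of nonempty sets is the family of nonempty level
      sets of the sum of the indicators.  Hence [front A] may be applied to the
      level sets of the word instead of the sets of the chain
      ([leq_count_chain]): the word alone determines how row [A] acts.

    The operator [mlq_op A l] does the latter.  A site of [A] receives the last
    level at which it is paired, or [l] if there is none; any other site receives
    the last level at which its upper bracket is unpaired, minus one, or 0.  By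
    monotonicity these numbers count, up to a shift, the levels [r] for which the
    site lies in [front A (level u r)] ([mlq_opE]).  The parameter [l] only shifts
    the nonzero entries of the word: the operators started at [l + 1] compute
    [pi_word] with its nonzero entries shifted by [l] ([Phi_fromE]), and the
    theorem is the case [l = 0].

    Monotonicity of [front] comes from counting brackets.  In the final matching,
    the arc spanned by a matched pair contains as many opening as closing
    brackets ([matched_arc_balanced]), while on an arc ending at an unmatched
    closing bracket the closing ones are strictly more numerous, and on an arc
    starting at an unmatched opening bracket the opening ones are
    ([unmatched_closing_arc], [unmatched_opening_arc]).  Enlarging the upper row
    only adds opening brackets, so it can neither unmatch a closing bracket nor
    match an opening one. *)

(** * The circle of brackets *)

Section Circle.

Variable n : nat.
Implicit Types (x y z w : bracket n).

Lemma bracket_pos_lt x : bracket_pos x < n.*2.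
Proof. by rewrite /bracket_pos; case: x => [[i ltin] []] /=; lia. Qed.

Lemma bracket_pos_inj : injective (@bracket_pos n).
Proof.
move=> [i b] [j c]; rewrite /bracket_pos /= => eqp.
have eqbc : b = c by case: b c eqp => [] [] /=; lia.
by rewrite eqbc in eqp *; congr pair; apply: val_inj => /=; lia.
Qed.

Lemma cdistE x y :
  cdist x y = if bracket_pos x <= bracket_pos y then bracket_pos y - bracket_pos x
              else bracket_pos y + n.*2 - bracket_pos x.
Proof.
have := bracket_pos_lt x; have := bracket_pos_lt y; rewrite /cdist => lty ltx.
case: leqP => lexy; last by rewrite modn_small //; lia.
by rewrite addnC -addnBA // modnDl modn_small //; lia.
Qed.

(** Statements about at most four brackets on the circle reduce to linear
    arithmetic on their positions, by cases on the wrap-arounds. *)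
Ltac circle :=
  rewrite /cbetween -?(inj_eq bracket_pos_inj) !cdistE;
  repeat match goal with x : bracket _ |- _ =>
    move: (bracket_pos_lt x); move: (bracket_pos x) => {}x end;
  repeat match goal with |- forall _ : nat, _ => intro end;
  repeat case: ifP; lia.

Lemma cdist_eq0 x z : (cdist x z == 0) = (z == x).
Proof. circle. Qed.

Lemma cdist0 x : cdist x x = 0.
Proof. by apply/eqP; rewrite cdist_eq0. Qed.

Lemma eq_cdist x y z : (cdist x y == cdist x z) = (y == z).
Proof. circle. Qed.

Lemma cdist_inj x : injective (cdist x).
Proof. by move=> y z /eqP; rewrite eq_cdist => /eqP. Qed.

Lemma cbetween_total_snd x y y' :
  y != x -> y' != x -> y != y' -> cbetween x y y' || cbetween x y' y.
Proof. circle. Qed.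

Lemma cbetween_total_fst x x' y :
  x != y -> x' != y -> x != x' -> cbetween x y x' || cbetween x' y x.
Proof. circle. Qed.

(** These two lemmas keep the partner of a bracket under an added pair [(x, y)]
    under that pair: a chord leaving the gap would pass over [x] or [y]. *)
Lemma cbetween_exit x y z w :
  cbetween x y z -> ~~ cbetween x y w -> w != y -> cbetween z w y.
Proof. circle. Qed.

Lemma cbetween_enter x y z w :
  cbetween x y z -> ~~ cbetween x y w -> w != x -> cbetween w z x.
Proof. circle. Qed.

Lemma cbetween_shorter_fst x y z : cbetween x y z -> cdist z y < cdist x y.
Proof. circle. Qed.

Lemma cbetween_shorter_snd x y z : cbetween x y z -> cdist x z < cdist x y.
Proof. circle. Qed.

Lemma cdist_le_closing x y z w :
  cdist x z <= cdist x y -> z != y -> ~~ cbetween z w y ->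
  cdist x w <= cdist x y.
Proof. circle. Qed.

Lemma cdist_le_opening x y z w :
  cdist x w <= cdist x y -> w != x -> ~~ cbetween z w x ->
  cdist x z <= cdist x y.
Proof. circle. Qed.

(** This is where the convention that the opening bracket of a site comes first
    enters. *)
Lemma cbetween_same_site x (j : 'I_n) :
  x != (j, false) -> ~~ x.2 -> cbetween x (j, true) (j, false).
Proof.
move=> neqx ox; have : x != (j, true) by apply: contraNneq ox => ->.
move: neqx; rewrite -!(inj_eq bracket_pos_inj) /cbetween !cdistE.
have := bracket_pos_lt x; have := bracket_pos_lt (j, true).
rewrite {ox} /bracket_pos; move: (x.1.*2 + x.2) => p /=.
by repeat case: ifP; lia.
Qed.

End Circle.

(** * The final matching *)

Section Matching.

Variables (n : nat) (A B : {set 'I_n}).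
Implicit Types (M : {set bracket n * bracket n}) (m : bracket n * bracket n).
Implicit Types (x y z : bracket n).

Definition matches m x := (m.1 == x) || (m.2 == x).

(** The invariant of the rounds of matching.  Its last clause says that the arc
    spanned by a pair of [M] is filled by other pairs of [M], none of which
    crosses it. *)
Record valid_matching M : Prop := ValidMatching {
  valid_opening : forall m, m \in M -> (m.1 \in brackets A B) && ~~ m.1.2;
  valid_closing : forall m, m \in M -> (m.2 \in brackets A B) && m.2.2;
  valid_inj1 : {in M &, injective fst};
  valid_inj2 : {in M &, injective snd};
  valid_nested : forall m z, m \in M -> z \in brackets A B ->
    cbetween m.1 m.2 z ->
    exists2 m', m' \in M & [/\ matches m' z, cbetween m.1 m.2 m'.1
                             & cbetween m.1 m.2 m'.2]}.

Lemma matched_fst M m : m \in M -> is_matched M m.1.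
Proof. by move=> mM; apply/exists_inP; exists m => //; rewrite eqxx. Qed.

Lemma matched_snd M m : m \in M -> is_matched M m.2.
Proof. by move=> mM; apply/exists_inP; exists m => //; rewrite eqxx orbT. Qed.

(** The pairs that one round adds to [M]. *)
Record matchable M m : Prop := Matchable {
  matchable_opening : (m.1 \in brackets A B) && ~~ m.1.2;
  matchable_closing : (m.2 \in brackets A B) && m.2.2;
  matchable_fst : ~~ is_matched M m.1;
  matchable_snd : ~~ is_matched M m.2;
  matchable_gap : forall z, z \in brackets A B -> cbetween m.1 m.2 z ->
    is_matched M z}.

Lemma match_roundP M m :
  reflect (m \in M \/ matchable M m) (m \in match_round A B M).
Proof.
rewrite in_setU; apply: (iffP orP) => -[mM | mM]; try by left.
  right; move: mM; rewrite inE => /and5P[b1 o1 u1 b2] /and3P[c2 u2 gap].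
  split; rewrite ?b1 ?b2 // => z zAB btw.
  by have /forall_inP/(_ z zAB)/implyP := gap; apply.
case: mM => /andP[b1 o1] /andP[b2 c2] u1 u2 gap; right.
rewrite inE b1 o1 u1 b2 c2 u2 /=; apply/forall_inP => z zAB; apply/implyP.
exact: gap.
Qed.

Lemma opening_neq_closing x y : ~~ x.2 -> y.2 -> x != y.
Proof. by move=> xo yc; apply: contraNneq xo => ->. Qed.

(** Two added pairs cannot share a bracket: one of the two other ends would lie
    in the gap of the other pair and so be matched already.  An added pair is not
    crossed by an old one either, since its unmatched ends would lie under that
    old pair. *)
Lemma match_round_valid M : valid_matching M -> valid_matching (match_round A B M).
Proof.
move=> vM; split.
- by move=> m /match_roundP[/(valid_opening vM)|[]].
- by move=> m /match_roundP[/(valid_closing vM)|[]].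
- move=> m m' /match_roundP[mM|fm] /match_roundP[m'M|fm'] eq1.
  + exact: (valid_inj1 vM).
  + by have := matchable_fst fm'; rewrite -eq1 matched_fst.
  + by have := matchable_fst fm; rewrite eq1 matched_fst.
  + case: m m' eq1 fm fm' => [x y] [x' y'] /= <-.
    move=> [/= /andP[_ xo] /andP[b c] _ u gap] [/= _ /andP[b' c'] _ u' gap'].
    congr pair; apply/eqP/negPn/negP => neqy.
    have ynx : y != x by rewrite eq_sym opening_neq_closing.
    have y'nx : y' != x by rewrite eq_sym opening_neq_closing.
    case/orP: (cbetween_total_snd ynx y'nx neqy).
      by move/(gap _ b'); rewrite (negPf u').
    by move/(gap' _ b); rewrite (negPf u).
- move=> m m' /match_roundP[mM|fm] /match_roundP[m'M|fm'] eq2.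
  + exact: (valid_inj2 vM).
  + by have := matchable_snd fm'; rewrite -eq2 matched_snd.
  + by have := matchable_snd fm; rewrite eq2 matched_snd.
  + case: m m' eq2 fm fm' => [x y] [x' y'] /= <-.
    move=> [/= /andP[b o] /andP[_ yc] u _ gap] [/= /andP[b' o'] _ u' _ gap'].
    congr pair; apply/eqP/negPn/negP => neqx.
    have xny : x != y by rewrite opening_neq_closing.
    have x'ny : x' != y by rewrite opening_neq_closing.
    case/orP: (cbetween_total_fst xny x'ny neqx).
      by move/(gap _ b'); rewrite (negPf u').
    by move/(gap' _ b); rewrite (negPf u).
move=> m z /match_roundP[mM | fm] zAB btw.
  have [m' m'M enc] := valid_nested vM mM zAB btw.
  by exists m' => //; apply/match_roundP; left.
have /exists_inP[m' m'M m'z] := matchable_gap fm zAB btw.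
exists m'; first by apply/match_roundP; left.
have [/andP[b1 o1] /andP[b2 c2] u1 u2 _] := fm.
have [/andP[b1' o1'] /andP[b2' c2']] := (valid_opening vM m'M, valid_closing vM m'M).
have inner t : t \in brackets A B -> ~~ is_matched M t -> ~~ cbetween m'.1 m'.2 t.
  move=> tAB ut; apply: contra ut => /(valid_nested vM m'M tAB)[p pM [pt _ _]].
  by apply/exists_inP; exists p.
split=> //; case/orP: (m'z) => /eqP eqz; rewrite ?eqz //.
- apply/negPn/negP => out; have := inner _ b1 u1.
  rewrite eqz (cbetween_enter btw out) //.
  by apply: contraNneq u1 => <-; rewrite matched_fst.
- apply/negPn/negP => out; have := inner _ b2 u2.
  rewrite eqz (cbetween_exit btw out) //.
  by apply: contraNneq u2 => <-; rewrite matched_snd.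
Qed.

Lemma valid_card M : valid_matching M -> #|M| <= n.
Proof.
move=> vM; rewrite -(card_in_imset (valid_inj1 vM)) -[leqRHS]card_ord.
have inj : {in fst @: M &, injective (fst : bracket n -> 'I_n)}.
  move=> x y /imsetP[m mM ->] /imsetP[m' m'M ->] eq1.
  have /andP[_ o] := valid_opening vM mM; have /andP[_ o'] := valid_opening vM m'M.
  by case: (m.1) (m'.1) eq1 o o' => [i []] [j []] //= ->.
by rewrite -(card_in_imset inj) max_card.
Qed.

Lemma iter_match_round_valid k : valid_matching (iter k (match_round A B) set0).
Proof.
elim: k => [|k IHk]; last exact: match_round_valid.
by split=> [m|m|m|m|m]; rewrite inE.
Qed.

Lemma cpair_valid : valid_matching (cpair A B).
Proof. exact: iter_match_round_valid. Qed.

(** A round that changes nothing is followed by none that does, every other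
    round adds a pair, and a valid matching has at most [n] pairs. *)
Lemma cpair_stable : match_round A B (cpair A B) = cpair A B.
Proof.
pose Mk k := iter k (match_round A B) set0.
have grow k : match_round A B (Mk k) = Mk k \/ k < #|Mk k.+1|.
  elim: k => [|k [stab|IHk]].
  - case: (set_0Vmem (Mk 1)) => [M10|[m mM]]; first by left; rewrite -[RHS]M10.
    by right; apply/card_gt0P; exists m.
  - by left; rewrite /Mk iterS !stab.
  - have [stab|neq] := eqVneq (match_round A B (Mk k.+1)) (Mk k.+1); first by left.
    right; apply: leq_ltn_trans IHk _; apply: proper_card.
    by rewrite properEneq eq_sym neq subsetUl.
have [//|] := grow n; rewrite ltnNge valid_card //; exact: iter_match_round_valid.
Qed.

(** Of all unmatched opening and closing brackets at the least distance, nothing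
    unmatched can lie in between, so that one more round would match them. *)
Lemma no_two_unmatched x y :
  x \in brackets A B -> ~~ x.2 -> y \in brackets A B -> y.2 ->
  is_matched (cpair A B) x || is_matched (cpair A B) y.
Proof.
have [d] := ubnP (cdist x y); elim: d x y => // d IHd x y.
rewrite ltnS => led bx ox b_y cy; apply/negPn/negP; rewrite negb_or => /andP[ux uy].
have : (x, y) \in cpair A B.
  rewrite -cpair_stable; apply/match_roundP; right; split; rewrite /= ?bx ?b_y //.
  move=> z bz btw; case: (boolP z.2) => [cz|oz].
    have := IHd x z _ bx ox bz cz; rewrite (negPf ux); apply.
    exact: leq_trans (cbetween_shorter_snd btw) led.
  have := IHd z y _ bz oz b_y cy; rewrite (negPf uy) orbF; apply.
  exact: leq_trans (cbetween_shorter_fst btw) led.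
by move/matched_fst; rewrite (negPf ux).
Qed.

Lemma matched_opening M x : valid_matching M -> ~~ x.2 -> is_matched M x ->
  exists2 m, m \in M & m.1 = x.
Proof.
move=> vM ox /exists_inP[m mM /orP[] /eqP eqx]; exists m => //.
by have /andP[_] := valid_closing vM mM; rewrite eqx (negPf ox).
Qed.

Lemma matched_closing M x : valid_matching M -> x.2 -> is_matched M x ->
  exists2 m, m \in M & m.2 = x.
Proof.
move=> vM cx /exists_inP[m mM /orP[] /eqP eqx]; exists m => //.
by have /andP[_] := valid_opening vM mM; rewrite eqx cx.
Qed.

Definition arc_openings (U : {set 'I_n}) x y : {set bracket n} :=
  [set z | [&& z.1 \in U, ~~ z.2 & cdist x z <= cdist x y]].

Definition arc_closings (L : {set 'I_n}) x y : {set bracket n} :=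
  [set z | [&& z.1 \in L, z.2 & cdist x z <= cdist x y]].

Lemma mem_opening z : ~~ z.2 -> (z \in brackets A B) = (z.1 \in B).
Proof. by move=> oz; rewrite inE (negPf oz). Qed.

Lemma mem_closing z : z.2 -> (z \in brackets A B) = (z.1 \in A).
Proof. by move=> cz; rewrite inE cz. Qed.

(** No pair crosses the pair [m], so the pairs inside the arc of [m] biject with
    its opening brackets and with its closing brackets. *)
Lemma matched_arc_balanced m : m \in cpair A B ->
  #|arc_openings B m.1 m.2| = #|arc_closings A m.1 m.2|.
Proof.
have vM := cpair_valid; set M := cpair A B in vM * => mM.
pose N := [set p in M | (cdist m.1 p.1 <= cdist m.1 m.2)
                        && (cdist m.1 p.2 <= cdist m.1 m.2)].
have subNM : {subset N <= M} by move=> p; rewrite inE => /andP[].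
have cover z : z \in brackets A B -> cdist m.1 z <= cdist m.1 m.2 ->
    exists2 p, p \in N & matches p z.
  move=> zAB; rewrite leq_eqVlt => /orP[/eqP/cdist_inj-> | ltz].
    by exists m; rewrite ?inE ?mM /matches ?eqxx ?orbT //= leqnn andbT cdist0.
  have [->|nz] := eqVneq z m.1.
    by exists m; rewrite ?inE ?mM /matches ?eqxx ?orbT //= leqnn andbT cdist0.
  have btw : cbetween m.1 m.2 z by rewrite /cbetween ltz lt0n cdist_eq0 nz.
  have [p pM [pz /andP[_ lt1] /andP[_ lt2]]] := valid_nested vM mM zAB btw.
  by exists p; rewrite // inE pM (ltnW lt1) (ltnW lt2).
have -> : arc_openings B m.1 m.2 = fst @: N.
  apply/setP=> z; rewrite inE; apply/and3P/imsetP => [[zB oz lez]|[p pN ->]].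
    have [|p pN /orP[]/eqP eqz] := cover z _ lez; first by rewrite mem_opening.
      by exists p.
    by have /andP[_] := valid_closing vM (subNM p pN); rewrite eqz (negPf oz).
  have /andP[b o] := valid_opening vM (subNM p pN).
  by rewrite o -mem_opening // b; move: pN; rewrite inE => /and3P[_ ->].
have -> : arc_closings A m.1 m.2 = snd @: N.
  apply/setP=> z; rewrite inE; apply/and3P/imsetP => [[zA cz lez]|[p pN ->]].
    have [|p pN /orP[]/eqP eqz] := cover z _ lez; first by rewrite mem_closing.
      by have /andP[_] := valid_opening vM (subNM p pN); rewrite eqz cz.
    by exists p.
  have /andP[b o] := valid_closing vM (subNM p pN).
  by rewrite o -mem_closing // b; move: pN; rewrite inE => /and3P[_ _ ->].
rewrite !card_in_imset // => p q /subNM pM /subNM qM.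
  exact: (valid_inj2 vM).
exact: (valid_inj1 vM).
Qed.

(** As [y] is unmatched, every opening bracket is matched, and those on the arc
    have their partners on the arc, since no pair passes over [y].  This injects
    the opening brackets into the closing ones, missing [y]. *)
Lemma unmatched_closing_arc x y : y \in brackets A B -> y.2 ->
  ~~ is_matched (cpair A B) y ->
  #|arc_openings B x y| < #|arc_closings A x y|.
Proof.
have vM := cpair_valid => bry cy uy; set M := cpair A B in vM uy.
pose N := [set p in M | cdist x p.1 <= cdist x y].
have subNM : {subset N <= M} by move=> p; rewrite inE => /andP[].
have -> : arc_openings B x y = fst @: N.
  apply/setP=> z; rewrite inE; apply/and3P/imsetP => [[zB oz lez]|[p pN ->]].
    have zAB : z \in brackets A B by rewrite mem_opening.
    have := no_two_unmatched zAB oz bry cy; rewrite (negPf uy) orbF.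
    by case/(matched_opening vM oz) => p pM eqz; exists p; rewrite // inE pM eqz.
  have /andP[b o] := valid_opening vM (subNM p pN).
  by rewrite o -mem_opening // b; move: pN; rewrite inE => /andP[_ ->].
rewrite card_in_imset; last by move=> p q /subNM pM /subNM; apply: (valid_inj1 vM).
rewrite -(@card_in_imset _ _ snd); last first.
  by move=> p q /subNM pM /subNM; apply: (valid_inj2 vM).
apply: proper_card; apply/properP; split.
  apply/subsetP => _ /imsetP[p pN ->]; have pM := subNM p pN.
  have /andP[b c] := valid_closing vM pM; rewrite inE c -mem_closing // b /=.
  have /andP[_ o] := valid_opening vM pM.
  apply: (@cdist_le_closing _ _ _ p.1).
  - by move: pN; rewrite inE => /andP[].
  - exact: opening_neq_closing.
  apply: contra uy => /(valid_nested vM pM bry)[q qM [qy _ _]].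
  by apply/exists_inP; exists q.
exists y; first by rewrite inE cy -mem_closing // bry leqnn.
by apply: contra uy => /imsetP[p /subNM pM ->]; apply: matched_snd.
Qed.

(** The mirror image of [unmatched_closing_arc]. *)
Lemma unmatched_opening_arc x y : x \in brackets A B -> ~~ x.2 ->
  ~~ is_matched (cpair A B) x ->
  #|arc_closings A x y| < #|arc_openings B x y|.
Proof.
have vM := cpair_valid => brx ox ux; set M := cpair A B in vM ux.
pose N := [set p in M | cdist x p.2 <= cdist x y].
have subNM : {subset N <= M} by move=> p; rewrite inE => /andP[].
have -> : arc_closings A x y = snd @: N.
  apply/setP=> z; rewrite inE; apply/and3P/imsetP => [[zA cz lez]|[p pN ->]].
    have zAB : z \in brackets A B by rewrite mem_closing.
    have := no_two_unmatched brx ox zAB cz; rewrite (negPf ux).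
    by case/(matched_closing vM cz) => p pM eqz; exists p; rewrite // inE pM eqz.
  have /andP[b o] := valid_closing vM (subNM p pN).
  by rewrite o -mem_closing // b; move: pN; rewrite inE => /andP[_ ->].
rewrite card_in_imset; last by move=> p q /subNM pM /subNM; apply: (valid_inj2 vM).
rewrite -(@card_in_imset _ _ fst); last first.
  by move=> p q /subNM pM /subNM; apply: (valid_inj1 vM).
apply: proper_card; apply/properP; split.
  apply/subsetP => _ /imsetP[p pN ->]; have pM := subNM p pN.
  have /andP[b o] := valid_opening vM pM; rewrite inE o -mem_opening // b /=.
  have /andP[_ c] := valid_closing vM pM.
  apply: (@cdist_le_opening _ _ _ _ p.2).
  - by move: pN; rewrite inE => /andP[].
  - by rewrite eq_sym opening_neq_closing.
  apply: contra ux => /(valid_nested vM pM brx)[q qM [qx _ _]].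
  by apply/exists_inP; exists q.
exists x; first by rewrite inE ox -mem_opening // brx cdist0.
by apply: contra ux => /imsetP[p /subNM pM ->]; apply: matched_fst.
Qed.

Lemma mem_paired_lower j :
  (j \in paired_lower A B) = (j \in A) && is_matched (cpair A B) (j, true).
Proof. by rewrite inE. Qed.

Lemma mem_unpaired_lower j :
  (j \in unpaired_lower A B) = (j \in A) && ~~ is_matched (cpair A B) (j, true).
Proof. by rewrite inE. Qed.

Lemma mem_paired_lower_unpaired j :
  (j \in paired_lower A B) = (j \in A) && (j \notin unpaired_lower A B).
Proof.
rewrite mem_unpaired_lower mem_paired_lower negb_and negbK.
by case: (j \in A).
Qed.

Lemma mem_unpaired_upper j :
  (j \in unpaired_upper A B) = (j \in B) && ~~ is_matched (cpair A B) (j, false).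
Proof. by rewrite inE. Qed.

Lemma unpaired_lower_or_upper0 :
  unpaired_lower A B = set0 \/ unpaired_upper A B = set0.
Proof.
have [|[i]] := set_0Vmem (unpaired_lower A B); first by left.
rewrite mem_unpaired_lower => /andP[iA ui]; right; apply/setP => j.
rewrite mem_unpaired_upper inE; apply: contraNF ui => /andP[jB uj].
have := @no_two_unmatched (j, false) (i, true).
by rewrite !inE (negPf uj) => /(_ jB isT iA isT).
Qed.

(** Both sides count the brackets outside the matching, up to the same number
    of matched pairs. *)
Lemma card_unpaired :
  #|unpaired_lower A B| + #|B| = #|unpaired_upper A B| + #|A|.
Proof.
have vM := cpair_valid; set M := cpair A B in vM.
have cardA : #|A| = #|unpaired_lower A B| + #|M|.
  rewrite addnC -(cardsID (unpaired_lower A B) A) addnC.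
  have -> : A :&: unpaired_lower A B = unpaired_lower A B.
    by apply/setIidPr/subsetP => j; rewrite mem_unpaired_lower => /andP[].
  congr (_ + _).
  rewrite -[RHS](@card_in_imset _ _ (fun m => m.2.1)); last first.
    move=> p q pM qM eqj; apply: (valid_inj2 vM) => //.
    have /andP[_] := valid_closing vM pM; have /andP[_] := valid_closing vM qM.
    by case: (p.2) (q.2) eqj => [i []] [j []] //= ->.
  apply: eq_card => j; rewrite in_setD mem_unpaired_lower -/M.
  apply/andP/imsetP => [[] | [p pM ->]].
    rewrite negb_and negbK => /orP[/negPf-> // | mj] _.
    by have [p pM eqj] := @matched_closing _ (j, true) vM isT mj; exists p; rewrite ?eqj.
  have /andP[b c] := valid_closing vM pM; rewrite -mem_closing // b.
  have := matched_snd pM; case: (p.2) c => i [] //= _ mi.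
  by rewrite mi.
have cardB : #|B| = #|unpaired_upper A B| + #|M|.
  rewrite addnC -(cardsID (unpaired_upper A B) B) addnC.
  have -> : B :&: unpaired_upper A B = unpaired_upper A B.
    by apply/setIidPr/subsetP => j; rewrite mem_unpaired_upper => /andP[].
  congr (_ + _).
  rewrite -[RHS](@card_in_imset _ _ (fun m => m.1.1)); last first.
    move=> p q pM qM eqj; apply: (valid_inj1 vM) => //.
    have /andP[_] := valid_opening vM pM; have /andP[_] := valid_opening vM qM.
    by case: (p.1) (q.1) eqj => [i []] [j []] //= ->.
  apply: eq_card => j; rewrite in_setD mem_unpaired_upper -/M.
  apply/andP/imsetP => [[] | [p pM ->]].
    rewrite negb_and negbK => /orP[/negPf-> // | mj] _.
    by have [p pM eqj] := @matched_opening _ (j, false) vM isT mj; exists p; rewrite ?eqj.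
  have /andP[b c] := valid_opening vM pM; rewrite -mem_opening // b.
  have := matched_fst pM; case: (p.1) c => i [] //= _ mi.
  by rewrite mi.
by rewrite cardA cardB addnCA.
Qed.

Lemma unpaired_upper0 : #|B| <= #|A| -> unpaired_upper A B = set0.
Proof.
move=> leBA; have [ul0|//] := unpaired_lower_or_upper0.
by apply/eqP; rewrite -cards_eq0; have := card_unpaired; rewrite ul0 cards0; lia.
Qed.

Lemma unpaired_lower0 : #|A| <= #|B| -> unpaired_lower A B = set0.
Proof.
move=> leBA; have [//|ul0] := unpaired_lower_or_upper0.
by apply/eqP; rewrite -cards_eq0; have := card_unpaired; rewrite ul0 cards0; lia.
Qed.

(** At a site of both rows, an unmatched opening bracket would lie directly
    before its own closing bracket, hence under the pair of the latter. *)
Lemma unpaired_upper_notin_lower j : j \in unpaired_upper A B -> j \notin A.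
Proof.
rewrite mem_unpaired_upper => /andP[jB uj]; apply: contra uj => jA.
have vM := cpair_valid; have [//|] := boolP (is_matched _ (j, false)).
have jx : (j, false) \in brackets A B by rewrite inE.
have jy : (j, true) \in brackets A B by rewrite inE.
move=> uj; have := no_two_unmatched jx isT jy isT; rewrite (negPf uj) /=.
case/(@matched_closing _ (j, true) vM isT) => p pM eqp.
have /andP[_ o] := valid_opening vM pM.
have [eq1|neq1] := eqVneq p.1 (j, false).
  by rewrite -eq1 matched_fst in uj.
have /(valid_nested vM pM jx)[q qM [qx _ _]] : cbetween p.1 p.2 (j, false).
  by rewrite eqp; apply: cbetween_same_site.
by case/negP: uj; apply/exists_inP; exists q.
Qed.

End Matching.

(** * Monotonicity of the pairing in the upper row *)

Section Monotonicity.

Variables (n : nat) (A B C : {set 'I_n}).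
Hypothesis subBC : B \subset C.

Lemma arc_openings_mono x y : #|arc_openings B x y| <= #|arc_openings C x y|.
Proof.
apply/subset_leq_card/subsetP => z; rewrite !inE => /and3P[zB -> ->].
by rewrite (subsetP subBC).
Qed.

(** If [j] were unpaired for [C], the arc of its pair for [B] would hold as many
    [B]-openings as closings, but fewer [C]-openings. *)
Lemma paired_lower_mono : paired_lower A B \subset paired_lower A C.
Proof.
apply/subsetP => j; rewrite !mem_paired_lower => /andP[jA mj].
have [m mM eqm] := @matched_closing _ _ _ _ (j, true) (cpair_valid A B) isT mj.
rewrite jA andTb; apply: contraT => uj.
have := @unmatched_closing_arc _ A C m.1 (j, true); rewrite inE jA => /(_ isT isT uj).
rewrite -eqm -(matched_arc_balanced mM) ltnNge; case/negP.
exact: arc_openings_mono.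
Qed.

Lemma unpaired_upper_mono : unpaired_upper A B \subset unpaired_upper A C.
Proof.
apply/subsetP => j; rewrite !mem_unpaired_upper => /andP[jB uj].
rewrite (subsetP subBC) // andTb; apply/negP => mj.
have [m mM eqm] := @matched_opening _ _ _ _ (j, false) (cpair_valid A C) isT mj.
have := @unmatched_opening_arc _ A B (j, false) m.2; rewrite inE jB => /(_ isT isT uj).
rewrite -eqm -(matched_arc_balanced mM) ltnNge; case/negP.
exact: arc_openings_mono.
Qed.

End Monotonicity.

(** * The first factor of the R matrix and the projection pi *)

Section Front.

Variable n : nat.
Implicit Types (A B C : {set 'I_n}) (s Q : seq {set 'I_n}) (j : 'I_n).

Definition front A B := (Rmx A B).1.

Lemma mem_front A B j :
  (j \in front A B) =
    if j \in A then j \in paired_lower A B else j \in unpaired_upper A B.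
Proof.
rewrite /front /= in_setU in_setD mem_unpaired_lower mem_paired_lower.
case: ifP => [jA | _]; last by rewrite andbF.
rewrite !andTb andbT negbK.
case: (boolP (j \in unpaired_upper A B)) => [/unpaired_upper_notin_lower|_].
  by rewrite jA.
by rewrite jA orbF.
Qed.

Lemma mem_front_in A B j : j \in A ->
  (j \in front A B) = (j \in paired_lower A B).
Proof. by move=> jA; rewrite mem_front jA. Qed.

Lemma mem_front_notin A B j : j \notin A ->
  (j \in front A B) = (j \in unpaired_upper A B).
Proof. by move=> jA; rewrite mem_front (negPf jA). Qed.

Lemma front_mono A B C : B \subset C -> front A B \subset front A C.
Proof.
move=> subBC; apply/subsetP => j; rewrite !mem_front.
by case: ifP => _; apply/subsetP; [apply: paired_lower_mono | apply: unpaired_upper_mono].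
Qed.

Lemma front0 A : front A set0 = set0.
Proof.
apply/setP => j; rewrite mem_front in_set0; case: ifP => _; last by rewrite !inE.
rewrite mem_paired_lower; apply/andP => -[_ mj].
have [m mM _] := @matched_closing _ _ _ _ (j, true) (cpair_valid _ _) isT mj.
by have /andP[b o] := valid_opening (cpair_valid _ _) mM; rewrite mem_opening // inE in b.
Qed.

(** [front A B] only loses elements of [A] or only gains elements, because
    unpaired brackets of both kinds do not coexist. *)
Lemma front_comparable A B : (A \subset front A B) || (front A B \subset A).
Proof.
apply/orP; have [ul0|uu0] := unpaired_lower_or_upper0 A B; [left|right].
  by rewrite /front /= ul0 setD0 subsetUl.
by rewrite /front /= uu0 setU0 subDset subsetUr.
Qed.

Definition nested B C := (B \subset C) || (C \subset B).

(** The sets [R_[1,i-1](Q)]_1, by recursion on the rows: [A] is the last row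
    that each later row moves past. *)
Fixpoint fronts Q :=
  if Q is A :: Q' then A :: map (front A) (fronts Q') else [::].

Lemma fronts_comparable Q : {in fronts Q &, forall B C, nested B C}.
Proof.
elim: Q => //= A Q IHQ B C; rewrite !inE.
case/predU1P => [-> | /mapP[B' B'Q ->]] /predU1P[-> | /mapP[C' C'Q ->]].
- by rewrite /nested subxx.
- exact: front_comparable.
- by rewrite /nested orbC; apply: front_comparable.
by apply/orP; case/orP: (IHQ _ _ B'Q C'Q) => /front_mono; [left|right].
Qed.

Lemma size_Rmx_at i Q : size (Rmx_at i Q) = size Q.
Proof. by elim: Q i => [|A Q IHQ] [|[|i]] //=; [case: Q {IHQ} | exact: (congr1 S (IHQ i.+1))]. Qed.

Lemma Rmx_range_cons k A Q :
  foldr (@Rmx_at n) (A :: Q) (index_iota 2 k.+2) = A :: Rmx_range 1 k Q.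
Proof.
rewrite /Rmx_range /index_iota !subSS subn0 (iotaDl 1 1) foldr_map.
have : all (leq 1) (iota 1 k) by apply/allP => i; rewrite mem_iota => /andP[].
by elim: (iota 1 k) => //= i r IHr /andP[i_gt0 /IHr ->]; case: i i_gt0.
Qed.

Lemma front_Rmx_range k A Q : k < size Q ->
  factor1 (Rmx_range 1 k.+1 (A :: Q)) = front A (factor1 (Rmx_range 1 k Q)).
Proof.
move=> ltkQ; rewrite {1}/Rmx_range /index_iota subSS subn0 /=.
have := Rmx_range_cons k A Q; rewrite /index_iota subSS subSS subn0 => ->.
have: size (Rmx_range 1 k Q) = size Q.
  by rewrite /Rmx_range; elim: index_iota => //= i r <-; rewrite size_Rmx_at.
by case: (Rmx_range 1 k Q) => //= szQ; rewrite -szQ in ltkQ.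
Qed.

Lemma fronts_Rmx_range Q :
  fronts Q = [seq factor1 (Rmx_range 1 i Q) | i <- iota 0 (size Q)].
Proof.
elim: Q => //= A Q ->; congr cons; rewrite (iotaDl 1 0) -!map_comp.
apply/eq_in_map => i; rewrite mem_iota add0n => /andP[_ ltiQ] /=.
by rewrite front_Rmx_range.
Qed.

Lemma pi_wordE Q j : pi_word Q j = count (fun C => j \in C) (fronts Q).
Proof.
rewrite ffunE big_add1 /= -sum1_count fronts_Rmx_range big_map [RHS]big_mkcond.
by rewrite /index_iota subn0; apply: eq_bigr => i _; rewrite ffunE; case: (j \in _).
Qed.

Lemma pi_word_cons A Q j :
  pi_word (A :: Q) j = (j \in A) + count (fun C => j \in front A C) (fronts Q).
Proof. by rewrite pi_wordE /= count_map. Qed.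

End Front.

(** * Level sets of a chain *)

Lemma chain_extremum (T : eqType) (e : rel T) (s : seq T) :
  transitive e -> {in s &, forall x y, e x y || e y x} -> s != [::] ->
  exists2 x, x \in s & {in s, forall y, e x y}.
Proof.
move=> e_tr; elim: s => //= x [_ | y s IHs] tot _.
  exists x => [|y]; rewrite ?mem_head // inE => /eqP->.
  by have := tot x x; rewrite orbb mem_head; apply.
have [||z zs minz] := IHs => //.
  by move=> u v us vs; apply: tot; rewrite inE ?us ?vs orbT.
have zxs : z \in x :: y :: s by rewrite inE zs orbT.
case/orP: (tot x z (mem_head _ _) zxs) => [exz | ezx].
  exists x => [|u]; rewrite ?mem_head // inE => /predU1P[-> | us].
    by have := tot x x; rewrite orbb mem_head; apply.
  exact: e_tr exz (minz u us).
by exists z => // u; rewrite inE => /predU1P[-> // | /minz].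
Qed.

Lemma sub_in_count (T : eqType) (a b : pred T) (s : seq T) :
  {in s, forall x, a x -> b x} -> count a s <= count b s.
Proof.
move=> sub; rewrite (@eq_in_count _ a (predI a b)).
  by apply: sub_count => x /andP[].
by move=> x xs; rewrite /=; case: (boolP (a x)) => // /(sub x xs) ->.
Qed.

Section Chain.

Variables (n : nat) (s : seq {set 'I_n}) (g : pred {set 'I_n}).
Hypothesis s_chain : {in s &, forall B C, nested B C}.
Hypothesis g_up : forall B C : {set 'I_n}, B \subset C -> g B -> g C.
Hypothesis g0 : ~~ g set0.

(** If at least [r] members of the chain satisfy [g], the least of them is
    contained in the level set.  Otherwise, each point of the level set lies in
    a member that does not satisfy [g], hence in the largest such member. *)
Lemma leq_count_chain r : 0 < r ->
  (r <= count g s) = g [set j | r <= count (fun C : {set 'I_n} => j \in C) s].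
Proof.
move=> r_gt0; set L := [set j | _]; apply/idP/idP => [ler|].
  have subs : {subset filter g s <= s} by move=> C; rewrite mem_filter => /andP[].
  have [|||C Cs minC] := @chain_extremum _ (fun B C : {set 'I_n} => B \subset C) (filter g s).
  - by move=> B C D; apply: subset_trans.
  - by move=> B C /subs Bs /subs; apply: s_chain.
  - by rewrite -size_eq0 size_filter -lt0n (leq_trans r_gt0).
  apply: g_up (C) _ _ _; last by move: Cs; rewrite mem_filter => /andP[].
  apply/subsetP => j jC; rewrite inE (leq_trans ler) // sub_in_count // => D Ds gD.
  by apply: (subsetP (minC D _)) jC; rewrite mem_filter gD.
apply: contraTT; rewrite -ltnNge => ltr.
have subs : {subset filter (predC g) s <= s} by move=> C; rewrite mem_filter => /andP[].
have escape j : j \in L -> exists2 C, C \in filter (predC g) s & j \in C.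
  rewrite inE => lej; apply/hasP; rewrite has_filter -filter_predI -has_filter.
  apply: contraLR lej => /hasPn noC; rewrite -ltnNge; apply: leq_ltn_trans ltr.
  apply: sub_in_count => C /noC.
  by rewrite /= negb_and negbK => /orP[/negPf-> |].
have [s0|sN0] := eqVneq (filter (predC g) s) [::].
  suff -> : L = set0 by [].
  by apply/setP=> j; rewrite in_set0; apply/negP => /escape[C]; rewrite s0.
have [||D Ds maxD] := @chain_extremum _ (fun B C : {set 'I_n} => C \subset B) _ _ _ sN0.
- by move=> B C D sBC sDB; apply: subset_trans sDB sBC.
- by move=> B C /subs Bs /subs Cs; rewrite orbC; apply: s_chain.
have : ~~ g D by move: Ds; rewrite mem_filter => /andP[].
apply: contra; apply: g_up; apply/subsetP => j /escape[C Cs jC].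
exact: (subsetP (maxD C Cs)) jC.
Qed.

End Chain.

(** * Iterated updates of one entry *)

(** The phases of the operators are folds in which each round sets some of the
    entries.  Here the effect on one entry is isolated, when at most one round
    sets it. *)
Section FoldUpdate.

Variables (n : nat) (step : word n -> nat -> word n) (j : 'I_n).
Variables (P : pred nat) (v : nat -> nat).
Hypothesis stepE : forall y r, step y r j = if P r then v r else y j.

Lemma foldl_update_none y s :
  {in s, forall r, ~~ P r} -> foldl step y s j = y j.
Proof.
elim: s y => //= r s IHs y noP; rewrite IHs => [|q qs].
  by rewrite stepE (negPf (noP r _)) ?mem_head.
by apply: noP; rewrite inE qs orbT.
Qed.

Lemma foldl_update_one y s r0 : r0 \in s -> P r0 ->
  {in s, forall r, P r -> r = r0} -> foldl step y s j = v r0.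
Proof.
move=> + Pr0; elim: s y => //= r s IHs y r0rs onlyP.
have [r0s | r0Ns] := boolP (r0 \in s).
  by apply: IHs => // q qs; apply: onlyP; rewrite inE qs orbT.
rewrite foldl_update_none => [|q qs].
  by move: r0rs; rewrite inE (negPf r0Ns) orbF => /eqP<-; rewrite stepE Pr0.
apply: contra r0Ns => /onlyP <- //.
by rewrite inE qs orbT.
Qed.

End FoldUpdate.

Lemma last_filter_iota (P : pred nat) a m (s := last a (filter P (iota a m))) :
  [/\ a <= s <= a + m.-1, (s == a) || P s
    & forall r, s < r < a + m -> ~~ P r].
Proof.
rewrite {}/s; elim: m => [|m [/andP[les les'] Ps maxs]].
  by rewrite /= addn0 leqnn eqxx; split=> // r; lia.
rewrite -addn1 iotaD filter_cat last_cat /=; case: ifP => [Pam | nPam] /=.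
  by split; rewrite ?Pam ?orbT //; [lia | move=> r; lia].
split=> // [|r /andP[ltsr ltr]]; first by lia.
have [-> | neq] := eqVneq r (a + m); first by rewrite nPam.
by apply: maxs; lia.
Qed.

(** * The operators of the projection Phi *)

Section Operator.

Variables (n : nat) (A : {set 'I_n}) (l : nat) (u : word n).
Hypothesis l_gt0 : 0 < l.
Hypothesis u_neq0 : u != word0 n.
Hypothesis u_gtl : forall j, 0 < u j -> l < u j.

Let a := word_min u.
Let K := word_max u.
Let s := split_level A u.

Lemma mem_posvals x : reflect (exists2 j, 0 < u j & x = u j) (x \in posvals u).
Proof.
rewrite mem_filter; apply: (iffP andP) => [[x_gt0 /codomP[j eqx]] | [j uj ->]].
  by exists j; rewrite -?eqx.
by rewrite uj codom_f.
Qed.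

Lemma leq_word_max j : u j <= K.
Proof.
have [->//|] := posnP (u j) => uj.
have uv : u j \in posvals u by apply/mem_posvals; exists j.
exact: (@leq_bigmax_seq _ _ predT id).
Qed.

Lemma word_min_leq j : 0 < u j -> a <= u j.
Proof.
move=> uj; have uv : u j \in posvals u by apply/mem_posvals; exists j.
rewrite /a /word_min; elim: (posvals u) uv => //= x t IHt.
by rewrite inE big_cons geq_min => /predU1P[-> | /IHt->]; rewrite ?leqnn ?orbT.
Qed.

Lemma word_neq0_pos : exists j, 0 < u j.
Proof.
apply/existsP; apply: contraNT u_neq0 => /existsPn u0.
by apply/eqP/ffunP => j; rewrite ffunE; have := u0 j; rewrite lt0n negbK => /eqP.
Qed.

Lemma word_min_gt : l < a.
Proof.
rewrite /a /word_min big_seq; elim/big_ind: _ => [|x y|x /mem_posvals[j uj ->]].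
- have [j uj] := word_neq0_pos.
  exact: leq_trans (u_gtl uj) (leq_word_max j).
- by rewrite leq_min => -> ->.
exact: u_gtl.
Qed.

Lemma level_low r : 0 < r <= a -> level u r = level u a.
Proof.
move=> /andP[r_gt0 ler]; apply/setP => j; rewrite !inE; apply/idP/idP => [lerj|].
  by apply: word_min_leq; apply: leq_trans lerj.
exact: leq_trans.
Qed.

Lemma level_high r : K < r -> level u r = set0.
Proof.
by move=> ltKr; apply/setP => j; rewrite !inE leqNgt (leq_ltn_trans (leq_word_max j)).
Qed.

Lemma split_levelP :
  [/\ a <= s <= K, (s == a) || (#|A| <= #|level u s|)
    & forall r, s < r <= K -> #|level u r| < #|A|].
Proof.
have leaK : a <= K.
  by have [j uj] := word_neq0_pos; apply: leq_trans (word_min_leq uj) (leq_word_max j).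
have [les Ps maxs] :=
  last_filter_iota (fun r => #|A| <= #|level u r|) a (K.+1 - a).
split=> [||r ltr]; rewrite ?ltnNge; first 1 last.
- exact: Ps.
- apply: maxs; rewrite -/(index_iota a K.+1) -/(split_level A u) -/s; lia.
by move: les; rewrite -/(index_iota a K.+1) -/(split_level A u) -/s; lia.
Qed.

(** If level [s] is at least as large as [A], every site of [A] is paired there;
    otherwise [s] is the least positive value of [u], and the positive
    levels up to [s] all coincide. *)
Lemma split_full r j : 0 < r <= s -> j \in front A (level u r) -> j \in A ->
  j \in front A (level u s).
Proof.
move=> ltr + jA; do 2!rewrite (mem_front_in _ jA).
have [_ /orP[/eqP eqs|full] _] := split_levelP.
  by rewrite eqs level_low // -eqs.
by rewrite (mem_paired_lower_unpaired A (level u s)) unpaired_lower0 // in_set0 jA.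
Qed.

(** By hypothesis, [c + l] is the last level [r] at which [j] lies in
    [front A (level u r)], if it exceeds [l].  It falls into the pairing phase if
    [j] is in [A], and into the collapsing phase if not. *)
Lemma mlq_opE j c :
  (forall r, l < r -> (r <= c + l) = (j \in front A (level u r))) ->
  mlq_op A l u j = if (j \in A) || (0 < c) then (j \in A) + c + l.-1 else 0.
Proof.
move=> cP; rewrite /mlq_op (negPf u_neq0) -/s -/K -/a.
have [/andP[leas lesK] _ small] := split_levelP.
have lta := word_min_gt.
set y1 := foldl _ (word0 n) _; set y2 := unpaired_step A l u y1.
pose Pp r := (j \in paired_lower A (level u r))
  && all (fun r' => j \notin paired_lower A (level u r')) (index_iota r.+1 K.+1).
have y1E y r : pairing_step A u y r j = if Pp r then r else y j.
  by rewrite ffunE.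
pose Pc r := (j \in unpaired_upper A (level u r))
  && (j \notin unpaired_upper A (level u r.+1)).
have y3E y r : collapsing_step A u y r j = if Pc r then r.-1 else y j.
  by rewrite ffunE.
have y2E : y2 j = if (j \in A) && (j \notin paired_lower A (level u s)) then l else y1 j.
  rewrite ffunE -/s mem_paired_lower_unpaired negb_and negbK andb_orr andbN /=.
  case: (boolP (j \in unpaired_lower _ _)) => [|_]; last by rewrite andbF.
  by rewrite mem_unpaired_lower => /andP[->].
have leK r : l < r -> r <= c + l -> r <= K.
  move=> ltlr; rewrite cP // leqNgt => jF; apply/negP => /level_high lvl0.
  by rewrite lvl0 front0 in_set0 in jF.
have [jA | jNA] := boolP (j \in A).
  have pE r : l < r -> (j \in paired_lower A (level u r)) = (r <= c + l).
    by move=> ltlr; rewrite cP // (mem_front_in _ jA).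
  rewrite (foldl_update_none (y3E)) => [|r _]; last first.
    rewrite negb_and; apply/orP; left; apply: contraL jA.
    exact: unpaired_upper_notin_lower.
  rewrite y2E jA pE ?(leq_trans lta) //= -ltnNge.
  have [ltcs|les] := ltnP.
    (* Below level [s] the site is unpaired by [split_full], and above it by the
       choice of [c]. *)
    suff -> : c = 0 by lia.
    apply/eqP; rewrite -leqn0 leqNgt; apply/negP => c_gt0.
    have : j \in front A (level u s).
      by apply: (@split_full (c + l)) => //; [lia | rewrite -cP; lia].
    by rewrite -cP; lia.
  (* Since [s > l], the level [c + l] at which the site is last paired exceeds [l]. *)
  have c_gt0 : 0 < c by lia.
  rewrite (@foldl_update_one _ _ _ _ id y1E _ _ (c + l)).
  - lia.
  - by rewrite mem_rev mem_index_iota les ltnS leK //; lia.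
  - rewrite /Pp pE ?leqnn /=; last by lia.
    by apply/allP => r; rewrite mem_index_iota => ltr; rewrite pE; lia.
  move=> r; rewrite mem_rev mem_index_iota => /andP[lesr ltrK] /andP[].
  rewrite pE; last by lia.
  rewrite leq_eqVlt => /predU1P[// | ltrc] /allP /(_ (c + l)).
  rewrite mem_index_iota ltrc ltnS leK // => [/(_ isT)|]; last by lia.
  by rewrite pE ?leqnn //; lia.
have uE r : l < r -> (j \in unpaired_upper A (level u r)) = (r <= c + l).
  by move=> ltlr; rewrite cP // (mem_front_notin _ jNA).
have y2j : y2 j = 0.
  rewrite y2E (negPf jNA) /= (foldl_update_none y1E) ?ffunE // => r _.
  by rewrite negb_and mem_paired_lower (negPf jNA).
have PcE r : l < r -> Pc r = (r == c + l).
  by move=> ltlr; rewrite /Pc !uE; lia.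
have [c0|c_gt0] := posnP c.
  rewrite (foldl_update_none y3E) // => r; rewrite mem_rev mem_index_iota => ler.
  by rewrite PcE; lia.
have r0P : c + l \in rev (index_iota a s.+1).
  rewrite mem_rev mem_index_iota; apply/andP; split; last first.
    (* Above level [s] the levels are smaller than [A], which leaves no upper
       bracket unpaired. *)
    rewrite ltnS leqNgt; apply/negP => lts.
    have := uE (c + l); rewrite leqnn unpaired_upper0 ?in_set0; first by lia.
    by rewrite ltnW // small // lts leK; lia.
  (* Below the least positive value, the levels [c + l] and [c + l + 1] would be
     the same set. *)
  rewrite leqNgt; apply/negP => lta'.
  have := uE (c + l); have := uE (c + l).+1.
  by rewrite (@level_low (c + l).+1) ?(@level_low (c + l)); lia.
rewrite (foldl_update_one y3E _ r0P).
- by rewrite /=; lia.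
- by rewrite PcE; lia.
by move=> r; rewrite mem_rev mem_index_iota => ler; rewrite PcE => [/eqP//|]; lia.
Qed.

End Operator.

(** * Comparison of the two projections *)

(** The shift by [l] happens on nonzero entries only, so that the level set at
    [r + l] of the shifted word is the level set at [r] of the original one for
    [r > 0]. *)
Lemma Phi_fromE n l (Q : seq {set 'I_n}) j :
  Phi_from l.+1 Q j = if 0 < pi_word Q j then pi_word Q j + l else 0.
Proof.
elim: Q l j => [|A Q IHQ] l j; first by rewrite pi_wordE /= !ffunE.
set u := Phi_from l.+2 Q; rewrite /= -/u pi_word_cons; set c := count _ _.
have cP r : l.+1 < r -> (r <= c + l.+1) = (j \in front A (level u r)).
  move=> ltlr; rewrite addnC -leq_subLR.
  rewrite (@leq_count_chain _ _ (fun C => j \in front A C)).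
  - congr (j \in front A _); apply/setP => i; rewrite !inE IHQ -pi_wordE.
    by case: posnP; lia.
  - exact: fronts_comparable.
  - by move=> B C /(front_mono A)/subsetP; apply.
  - by rewrite front0 in_set0.
  lia.
have [u0 | uN0] := eqVneq u (word0 n).
  rewrite u0 /mlq_op eqxx !ffunE; suff -> : c = 0 by case: (j \in A) => /=; lia.
  have := cP l.+2; suff -> : level u l.+2 = set0 by rewrite front0 in_set0; lia.
  by apply/setP => i; rewrite u0 !inE ffunE.
rewrite (mlq_opE _ uN0 _ cP) //; last by move=> i; rewrite IHQ; case: ifP; lia.
by case: (j \in A) => //=; rewrite add0n.
Qed.

Theorem corollary4p10 (n : nat) (n_ge1 : 1 <= n) (alpha : seq nat)
  (Q : seq {set 'I_n}) (fmlqQ : is_fmlq alpha Q) :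
  Phi Q = pi_word Q.
Proof.
by apply/ffunP => j; rewrite /Phi Phi_fromE addn0; case: posnP.
Qed.
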